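(* Let $D$ be a pre-divergence on a Polish space $\mathcal{X}$, $c$ a cost function, and $\mu\in\mathcal{P}(\mathcal{X})$ such that (1) $P\mapsto D(P\|\mu)$ is lower semicontinuous and has compact sublevel sets, and (2) $c(x_1,x_2)=0$ if and only if $x_1=x_2$. For $r>0$ let $c_r=rc$. Then for every $\nu\in\mathcal{P}(\mathcal{X})$, \[\lim_{r\to\infty}D^{c_r}(\nu\|\mu)=D(\nu\|\mu).\]
   Context: $\mathcal{P}(\mathcal{X})$ is the set of Borel probability measures on the Polish space $\mathcal{X}$ with the weak topology. A pre-divergence is $D:\mathcal{P}(\mathcal{X})\times\mathcal{P}(\mathcal{X})\to[0,\infty]$ with $D(\mu\|\mu)=0$ for all $\mu$. A cost function is a lower semicontinuous $c:\mathcal{X}\times\mathcal{X}\to[0,\infty]$, with OT cost $C(\mu,\nu)=\inf\{\int c\,d\pi:\pi_1=\mu,\pi_2=\nu\}$. For a cost function $c'$ with OT cost $C'$, $D^{c'}(\nu\|\mu)=\inf_{\eta\in\mathcal{P}(\mathcal{X})}\{D(\eta\|\mu)+C'(\eta,\nu)\}$. *)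

(* Defs.v *)
From HB Require Import structures.
From mathcomp Require Import all_boot all_order all_algebra.
From mathcomp Require Import all_classical all_reals all_analysis.
Set Implicit Arguments. Unset Strict Implicit. Unset Printing Implicit Defensive.
Import Order.TTheory GRing.Theory Num.Theory.
Import numFieldNormedType.Exports.
HB.saturate prod.
Local Open Scope classical_set_scope.
Local Open Scope ring_scope.

(* Polish space: a (pointed) complete metric space, Hausdorff, separable. *)
Definition separable_space (X : topologicalType) :=
  exists S : set X, countable S /\ closure S = setT.

Definition Borel (X : ptopologicalType) := g_sigma_algebraType (@open X).

Definition Prob (X : ptopologicalType) (R : realType) := probability (Borel X) R.

Definition bounded_continuous (X : topologicalType) (R : realType) (f : X -> R) :=
  continuous f /\ exists M : R, forall x, `|f x| <= M.

(* Open sets of the weak topology on P(X): generated by the maps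
   P |-> \int f dP, f bounded continuous (finite intersections of subbasic
   neighbourhoods). *)
Definition weak_open (X : ptopologicalType) (R : realType) (A : set (Prob X R)) :=
  forall P, A P -> exists (fs : seq (X -> R)) (eps : R), 0 < eps /\
    (forall f, f \in fs -> bounded_continuous f) /\
    [set Q : Prob X R | forall f, f \in fs ->
        (`| \int[Q]_x (f x)%:E - \int[P]_x (f x)%:E | < eps%:E)%E] `<=` A.

Definition weak_lsc (X : ptopologicalType) (R : realType) (F : Prob X R -> \bar R) :=
  forall a : R, weak_open [set P | (a%:E < F P)%E].

Definition weak_compact (X : ptopologicalType) (R : realType) (K : set (Prob X R)) :=
  forall (I : Type) (U : I -> set (Prob X R)), (forall i, weak_open (U i)) ->
    K `<=` \bigcup_i U i ->
    exists J : set I, finite_set J /\ K `<=` \bigcup_(i in J) U i.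

Definition pre_divergence (X : ptopologicalType) (R : realType)
  (D : Prob X R -> Prob X R -> \bar R) :=
  (forall P Q, (0 <= D P Q)%E) /\ (forall P, D P P = 0%E).

Definition cost_function (X : ptopologicalType) (R : realType) (c : X -> X -> \bar R) :=
  (forall x y, (0 <= c x y)%E) /\
  lower_semicontinuous (fun p : X * X => c p.1 p.2).

Definition coupling (X : ptopologicalType) (R : realType) (mu nu : Prob X R)
  (pi : Prob (X * X)%type R) :=
  (forall A : set X, measurable (A : set (Borel X)) ->
     pi ((fun p : X * X => p.1) @^-1` A) = mu A) /\
  (forall A : set X, measurable (A : set (Borel X)) ->
     pi ((fun p : X * X => p.2) @^-1` A) = nu A).

Definition OTcost (X : ptopologicalType) (R : realType) (c : X -> X -> \bar R)
  (mu nu : Prob X R) : \bar R :=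
  ereal_inf [set (\int[pi]_p c p.1 p.2)%E | pi in [set pi | coupling mu nu pi]].

Definition Dc (X : ptopologicalType) (R : realType)
  (D : Prob X R -> Prob X R -> \bar R) (c : X -> X -> \bar R)
  (nu mu : Prob X R) : \bar R :=
  ereal_inf [set (D eta mu + OTcost c eta nu)%E | eta in [set: Prob X R]].

Definition scale_cost (X : Type) (R : realType) (r : R) (c : X -> X -> \bar R) :=
  fun x y => (r%:E * c x y)%E.

(* Main.v *)
(** Taking eta = nu and the diagonal coupling gives D^{c_r}(nu|mu) <= D(nu|mu)
    for every r > 0.  For the converse bound fix a < D(nu|mu).  It suffices to
    bound the transport cost C(eta, nu) below by some d > 0 over the weakly
    compact set {eta | D(eta|mu) <= a}, since then D^{c_r}(nu|mu) >= a as soon as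
    r d >= a; by compactness a bound near each P <> nu is enough.

    Such P and nu are both tight, so there are disjoint compact sets L and K with
    P(L) + nu(K) > 1.  As c is lower semicontinuous and positive off the diagonal,
    c >= d on U x K for some open U containing L and some d > 0.  Every coupling
    of eta and nu gives U x K mass at least eta(U) + nu(K) - 1, and a Urysohn
    function between L and U keeps this bounded away from 0 for eta near P.  No
    limit of couplings, hence no Prokhorov theorem, is needed. *)

Require Import Defs.
From HB Require Import structures.
From mathcomp Require Import all_boot all_order all_algebra.
From mathcomp Require Import all_classical all_reals all_analysis.
From mathcomp Require Import measurable_realfun lra.
Import Order.TTheory GRing.Theory Num.Theory.
Import numFieldNormedType.Exports.
Local Open Scope classical_set_scope.
Local Open Scope ring_scope.
Set Implicit Arguments.
Unset Strict Implicit.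
Unset Printing Implicit Defensive.

(** * Borel measurability of sets and functions *)

Lemma measurable_Borel_open (X : ptopologicalType) (A : set X) :
  open A -> measurable (A : set (Borel X)).
Proof. by move=> oA; exact: sub_sigma_algebra. Qed.

Lemma measurable_Borel_closed (X : ptopologicalType) (A : set X) :
  closed A -> measurable (A : set (Borel X)).
Proof.
move=> cA; rewrite -(setCK A); apply: measurableC.
by apply: measurable_Borel_open; exact: closed_openC.
Qed.

Lemma continuous_measurable_Borel (X Y : ptopologicalType) (f : X -> Y) :
  continuous f -> measurable_fun setT (f : Borel X -> Borel Y).
Proof.
move=> /continuousP cf.
apply: (@measurability _ _ (Borel X) (Borel Y) _ _ (@open Y)) => //.
by move=> _ [U oU <-]; rewrite setTI; apply: measurable_Borel_open; exact: cf.
Qed.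

Lemma lsc_measurable_Borel (X : ptopologicalType) (R : realType)
    (f : X -> \bar R) :
  lower_semicontinuous f -> measurable_fun (T := Borel X) setT f.
Proof.
move=> /lower_semicontinuousP lf.
apply: (measurability _ (ErealGenOInfty.measurableE R)).
move=> /= _ [_ [a ->]] <-; apply: measurableI => //.
by rewrite preimage_itvoy; apply: measurable_Borel_open; exact: lf.
Qed.

Lemma continuous_measurable_Borel_real (X : ptopologicalType) (R : realType)
    (f : X -> R) :
  continuous f -> measurable_fun (T := Borel X) setT f.
Proof.
move=> cf; apply/measurable_EFinP; apply: lsc_measurable_Borel => x a.
rewrite /= lte_fin => afx; exists [set y | a < f y]; last by move=> y; rewrite lte_fin.
by apply: cvgr_gt afx; exact: cf.
Qed.

(** * Compactness by total boundedness, and tightness of a single measure *)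

Lemma ultra_bigcup_ord (T : Type) (F : set_system T) (C : nat -> set T) n :
  UltraFilter F -> F (\bigcup_(i < n) C i) -> exists i, F (C i).
Proof.
move=> FU; elim: n => [|n IHn].
  by rewrite bigcup_mkord big_ord0 => /filter_ex[].
rewrite bigcup_mkord big_ord_recr/= -bigcup_mkord => FCn.
have [|FnC] := in_ultra_setVsetC (C n) FU; first by exists n.
apply: IHn; apply: filterS2 FCn FnC => x [//|Cx nCx]; by [].
Qed.

Lemma dense_seq (R : realType) (X : pseudoPMetricType R) :
  separable_space X ->
  exists s : nat -> X, forall x (e : R), 0 < e -> exists i, ball (s i) e x.
Proof.
move=> [S [cS dS]].
have [S0|] := pfcard_geP cS.
  (* [X] is pointed, so a dense set cannot be empty. *)
  have : closure S point by rewrite dS.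
  by rewrite S0 closure0.
move=> [s]; exists s => x e e0.
have : closure S x by rewrite dS.
move=> /(_ _ (nbhsx_ballx x e e0))[y [Sy xy]].
have [i _ iy] := @surj _ _ _ _ s y Sy.
by exists i; rewrite iy; exact: ball_sym.
Qed.

(** An ultrafilter containing [K] selects, for each [n], one of the finitely many sets [C n i],
    hence contains balls of arbitrarily small radius and is Cauchy. Completeness provides a limit,
    and closedness keeps it in [K]. *)
Lemma totally_bounded_compact (R : realType) (X : completePseudoMetricType R)
    (K : set X) (C : nat -> nat -> set X) (N : nat -> nat) (c : nat -> nat -> X):
  closed K ->
  (forall n, K `<=` \bigcup_(i < N n) C n i) ->
  (forall n i, C n i `<=` ball (c n i) (n.+1%:R^-1)) ->
  compact K.
Proof.
move=> clK KC Cc; rewrite compact_ultra => F FU FK.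
have cF : cauchy F.
  apply: cauchy_exP => e e0.
  have [n ne] : exists n, (n.+1%:R^-1 : R) < e.
    by have [n] := ltr_add_invr e0; rewrite add0r; exists n.
  have [|i Fi] := @ultra_bigcup_ord _ F (C n) (N n) FU.
    exact: filterS FK.
  exists (c n i); apply: filterS Fi; apply: (subset_trans (Cc n i)).
  exact/le_ball/ltW.
have cvF : cvg F by exact: cauchy_cvg.
exists (lim F); split; last exact: cvF.
apply: clK => B nB.
have FB : F B by exact: cvF.
exact: filter_ex (filterI FK FB).
Qed.

Lemma bigcup_ord_homo (T : Type) (C : nat -> set T) :
  {homo (fun n => \bigcup_(i < n) C i) : n m / (n <= m)%N >-> (n <= m)%O}.
Proof.
move=> n m nm; apply/subsetPset; apply: bigcup_subset => i /=.
by move=> /leq_trans; exact.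
Qed.

Lemma Prob_setT (R : realType) (X : ptopologicalType) (P : Prob X R) :
  P [set: X] = 1%E.
Proof. exact: probability_setT. Qed.

Lemma Prob_setC (R : realType) (X : ptopologicalType) (P : Prob X R)
    (A : set X) :
  measurable (A : set (Borel X)) -> P (~` A) = (1 - P A)%E.
Proof. by move=> mA; exact: probability_setC. Qed.

Lemma Prob_fineK (R : realType) (X : ptopologicalType) (P : Prob X R)
    (A : set X) :
  measurable (A : set (Borel X)) -> (fine (P A))%:E = P A.
Proof. by move=> mA; apply: fineK; exact: fin_num_measure. Qed.

Lemma Prob_bigcup_gt (R : realType) (X : ptopologicalType) (P : Prob X R)
    (F : nat -> set X) (t : \bar R) :
  (forall n, measurable (F n : set (Borel X))) ->
  {homo F : n m / (n <= m)%N >-> (n <= m)%O} ->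
  (t < P (\bigcup_n F n))%E -> exists n, (t < P (F n))%E.
Proof.
move=> mF ndF tP; apply: contrapT => /forallNP H.
have cvP := @nondecreasing_cvg_mu _ _ _ P _ mF (bigcup_measurable (fun n _ => mF n)) ndF.
have : (P (\bigcup_n F n) <= t)%E.
  apply: (cvge_le _ cvP); apply: nearW => n.
  by rewrite leNgt; apply/negP; exact: H.
by rewrite leNgt tP.
Qed.

(** Ulam's theorem. At each scale [n], continuity from below yields finitely many closed pieces
    missing mass at most [e / 2 ^ n.+1]. The intersection over [n] is closed and totally bounded,
    and the missing masses sum to at most [e]. *)
Lemma Prob_tight (R : realType) (X : completePseudoMetricType R)
    (P : Prob X R) (e : R) :
  separable_space X -> 0 < e ->
  exists K : set X, [/\ closed K, compact K & (P (~` K) <= e%:E)%E].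
Proof.
move=> sX e0; have [s ds] := dense_seq sX.
(* Half of the target radius: the closure of a ball of radius [r n] lies in the ball of twice that
   radius. *)
pose r n : R := n.+1%:R^-1 / 2.
have r0 n : 0 < r n by rewrite divr_gt0.
pose C n i := closure (ball (s i) (r n)).
pose A n N := \bigcup_(i < N) C n i.
have cA n N : closed (A n N).
  rewrite /A bigcup_mkord; apply: closed_bigsetU => i _; exact: closed_closure.
have Acov n : \bigcup_N A n N = setT.
  apply/seteqP; split=> // x _.
  have [i six] := ds x (r n) (r0 n).
  by exists i.+1 => //; exists i => /=; [exact: ltnSn|exact: subset_closure].
have /choice[N HN] n : exists N, (P (~` A n N) <= (e / (2 ^ n.+1)%:R)%:E)%E.
  set d := e / _.
  have d0 : 0 < d by rewrite divr_gt0// ltr0n expn_gt0.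
  have mA N : measurable (A n N : set (Borel X)) by exact: measurable_Borel_closed.
  have [||N] := @Prob_bigcup_gt R X P (A n) (1 - d)%:E mA.
  - exact: bigcup_ord_homo.
  - by rewrite Acov Prob_setT lte_fin ltrBlDr ltrDl.
  move=> dA; exists N; rewrite Prob_setC//.
  move: dA; rewrite -(Prob_fineK P (mA N)).
  by rewrite lte_fin -EFinB lee_fin; lra.
exists (\bigcap_n A n (N n)); split.
- by apply: closed_bigI => n _.
- apply: (@totally_bounded_compact _ _ _ C N (fun _ => s)).
  + by apply: closed_bigI => n _.
  + by move=> n; apply: bigcap_inf.
  + move=> n i x Cx; have [y [six xy]] := Cx _ (nbhsx_ballx x (r n) (r0 n)).
    by apply: ball_split six _; exact: ball_sym.
- rewrite setC_bigcap.
  have mA n : measurable (~` A n (N n) : set (Borel X)).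
    by apply: measurableC; exact: measurable_Borel_closed.
  have := @measure_sigma_subadditive _ R (Borel X) P (\bigcup_n ~` A n (N n)) _ mA
    (bigcup_measurable (fun n _ => mA n)) (@subset_refl _ _).
  move=> /le_trans; apply.
  apply: le_trans (epsilon_trick0 xpredT (ltW e0)).
  by apply: lee_nneseries => [n _ _|n _]; [exact: measure_ge0|exact: HN].
Qed.

(** * Inner regularity and separation of measures by disjoint compact sets *)

Lemma Prob_ext_closed (R : realType) (X : ptopologicalType) (P Q : Prob X R) :
  (forall F : set X, closed F -> P F = Q F) ->
  forall A : set X, measurable (A : set (Borel X)) -> P A = Q A.
Proof.
(* Open sets are stable under intersection and generate the Borel sets, so agreement on them
   suffices; complements reduce it to closed sets. *)
move=> PQ A mA; apply: (@measure_unique _ R (Borel X) open (fun=> setT)) => //.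
- by move=> U V; exact: openI.
- by move=> _; exact: openT.
- by rewrite bigcup_const.
- move=> U oU; rewrite -(setCK U).
  have mC : measurable (~` U : set (Borel X)).
    by apply: measurable_Borel_closed; exact: open_closedC.
  by rewrite [LHS]Prob_setC// [RHS]Prob_setC// PQ//; exact: open_closedC.
- by move=> _; rewrite [X in (X < _)%E]Prob_setT ltry.
Qed.

(** Tightness gives a compact set missing at most half of the gap [P F - t]; cutting [F] with it
    keeps the mass above [t]. *)
Lemma closed_compact_gt (R : realType) (X : completePseudoMetricType R)
    (P : Prob X R) (F : set X) (t : R) :
  separable_space X -> closed F -> (t%:E < P F)%E ->
  exists K : set X, [/\ closed K, compact K, K `<=` F & (t%:E < P K)%E].
Proof.
move=> sX cF tF.
have mF : measurable (F : set (Borel X)) by exact: measurable_Borel_closed.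
move: tF; rewrite -(Prob_fineK P mF) lte_fin => tF.
have e0 : 0 < (fine (P F) - t) / 2 by rewrite divr_gt0// subr_gt0.
have [K [cK kK PK]] := Prob_tight P sX e0.
have cFK : closed (F `&` K) by exact: closedI.
exists (F `&` K); split=> //.
  rewrite setIC; exact: compact_closedI.
have mFK : measurable (F `&` K : set (Borel X)) by exact: measurable_Borel_closed.
have mK : measurable (~` K : set (Borel X)).
  by apply: measurableC; exact: measurable_Borel_closed.
have : (P F <= P (F `&` K) + P (~` K))%E.
  apply: le_trans (measureU2 P mFK mK); apply: le_measure; rewrite ?inE//.
    exact: measurableU.
  by move=> x Fx; have [|] := pselect (K x); [left|right].
move: PK; rewrite -(Prob_fineK P mF) -(Prob_fineK P mFK) -(Prob_fineK P mK).
by rewrite -EFinD !lee_fin lte_fin; lra.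
Qed.

Lemma open_bigcup_closed (R : realType) (X : pseudoPMetricType R) (U : set X) :
  open U -> exists F : nat -> set X,
    [/\ forall n, closed (F n), {homo F : n m / (n <= m)%N >-> (n <= m)%O}
      & \bigcup_n F n = U].
Proof.
move=> oU; pose B n := \bigcup_(x in ~` U) (ball x (n.+1%:R^-1 : R))^°.
have r0 n : 0 < (n.+1%:R^-1 : R) by rewrite invr_gt0.
exists (fun n => ~` B n); split.
- by move=> n; apply: open_closedC; apply: bigcup_open => x _; exact: open_interior.
- move=> n m nm; apply/subsetPset; apply: subsetC.
  apply: subset_bigcup => x _; apply: interiorS; apply: le_ball.
  by rewrite lef_pV2 ?posrE// ler_nat.
apply/seteqP; split=> x.
  move=> [n _]; apply: contra_notP => Ux; exists x => //.
  exact: nbhsx_ballx.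
move=> Ux; have := oU; rewrite openE => /(_ _ Ux).
rewrite /interior -nbhs_ballE => -[e /= e0 xeU].
have [n] := ltr_add_invr e0; rewrite add0r => ne.
exists n => // -[y Uy /interior_subset yx]; apply: Uy; apply: xeU.
by apply: ball_sym; apply: le_ball yx; exact: ltW.
Qed.

Lemma open_compact_gt (R : realType) (X : completePseudoMetricType R)
    (P : Prob X R) (U : set X) (t : R) :
  separable_space X -> open U -> (t%:E < P U)%E ->
  exists K : set X, [/\ closed K, compact K, K `<=` U & (t%:E < P K)%E].
Proof.
move=> sX oU; have [F [cF ndF <-]] := open_bigcup_closed oU => tF.
have [//|n tFn] := Prob_bigcup_gt _ ndF tF.
  by move=> n; exact: measurable_Borel_closed.
have [K [cK kK KF tK]] := closed_compact_gt sX (cF n) tFn.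
by exists K; split=> // x /KF Fx; exists n.
Qed.

Lemma disjoint_compact_lt (R : realType) (X : completePseudoMetricType R)
    (P Q : Prob X R) (F : set X) :
  separable_space X -> closed F -> (P F < Q F)%E ->
  exists L K : set X, [/\ closed L /\ compact L, closed K /\ compact K,
    L `&` K = set0 & (1 < P L + Q K)%E].
Proof.
move=> sX cF.
have mF : measurable (F : set (Borel X)) by exact: measurable_Borel_closed.
rewrite -(Prob_fineK P mF) => /(closed_compact_gt sX cF)[K [cK kK KF PQK]].
have mK : measurable (K : set (Borel X)) by exact: measurable_Borel_closed.
have PKF : (P K <= P F)%E by apply: le_measure; rewrite ?inE.
have [|L [cL kL LK tL]] :=
    @open_compact_gt _ _ P (~` K) (1 - fine (Q K)) sX (closed_openC cK).
  rewrite Prob_setC//; move: PKF PQK.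
  rewrite -(Prob_fineK P mF) -(Prob_fineK P mK) -(Prob_fineK Q mK).
  by rewrite -EFinB !lte_fin lee_fin /=; lra.
exists L, K; split=> //; first exact/disjoints_subset.
have mL : measurable (L : set (Borel X)) by exact: measurable_Borel_closed.
move: tL; rewrite -(Prob_fineK P mL) -(Prob_fineK Q mK) -EFinD !lte_fin /=; lra.
Qed.

Lemma disjoint_compact (R : realType) (X : completePseudoMetricType R)
    (P Q : Prob X R) (F : set X) :
  separable_space X -> closed F -> P F <> Q F ->
  exists L K : set X, [/\ closed L /\ compact L, closed K /\ compact K,
    L `&` K = set0 & (1 < P L + Q K)%E].
Proof.
move=> sX cF /eqP; rewrite neq_lt => /orP[|] PQ; first exact: disjoint_compact_lt PQ.
(* The conclusion is symmetric under exchanging [(P, L)] with [(Q, K)]. *)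
have [L [K [? ? LK ?]]] := disjoint_compact_lt sX cF PQ.
by exists K, L; split=> //; [rewrite setIC|rewrite addeC].
Qed.

(** * Lower bounds on the cost of couplings near a fixed measure *)

Lemma lsc_gt_tube (R : realType) (X Y : topologicalType) (c : X -> Y -> \bar R)
    (L : set X) (K : set Y) :
  lower_semicontinuous (fun p : X * Y => c p.1 p.2) ->
  compact L -> compact K -> (forall x y, L x -> K y -> (0 < c x y)%E) ->
  exists (U : set X) (d : R), [/\ open U, L `<=` U, 0 < d &
    forall x y, U x -> K y -> (d%:E <= c x y)%E].
Proof.
move=> lc /compact_near_coveringP kL /compact_near_coveringP kK c0.
pose V (d : R) := [set x | forall y, K y -> (d%:E <= c x y)%E].
(* Compactness is used in its near-covering form: a bound valid near each point of [L] for all small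
   [d] holds on all of [L] for one small [d]. *)
suff : \forall d \near 0^'+, L `<=` (V d)^°.
  move=> /(filterI (nbhs_right_gt 0))/filter_ex[d [d0 LVd]].
  exists (V d)^°, d; split => //; first exact: open_interior.
  by move=> x y /interior_subset; exact.
apply: (kL _ _ (fun d x => (V d)^° x)) => x Lx.
(* Compactness of [K] is applied along the product filter, so that the point of [X] and the level
   [d] vary together, uniformly in [y]. *)
have [y Ky|[A B] [/= xA B0] AB] := kK _ (filter_prod (nbhs x) 0^'+)
    (fun xd y => (xd.2%:E <= c xd.1 y)%E).
- have [e [e0 ec]] : exists e : R, 0 < e /\ (e%:E < c x y)%E.
    have := c0 _ _ Lx Ky; case: (c x y) => [r| |] //.
      by rewrite lte_fin => r0; exists (r / 2); rewrite lte_fin; split; lra.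
    by move=> _; exists 1; rewrite ltry.
  have [W [[W1 W2] /= [xW1 yW2] WW]] := lc (x, y) e ec.
  move=> Wc; exists (W2, W1 `*` [set d | d <= e]); last first.
    move=> [y' [x' d]] /= [W2y' [W1x' de]].
    by apply: le_trans (ltW (Wc (x', y') _)); [rewrite lee_fin|exact: WW].
  split=> //=; exists (W1, [set d | d <= e]) => //; split => //=.
  exact: nbhs_right_le.
(* For [d] in [B] all of [A] lies in [V d], hence the interior of [A] lies in that of [V d]. *)
exists (A^°, B) => /=; first by split => //; exact: nbhs_interior.
move=> [x' d] [/= Ax' Bd]; apply: interiorS Ax' => z Az y Ky.
exact: (AB (z, d)).
Qed.

(** Union bound: the complement of the rectangle is covered by two sets of masses [1 - P U] and
    [1 - Q K]. *)
Lemma coupling_rectangle (R : realType) (X : ptopologicalType)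
    (P Q : Prob X R) (pi : Prob (X * X)%type R) (U K : set X) :
  coupling P Q pi -> measurable (U : set (Borel X)) ->
  measurable (K : set (Borel X)) ->
  (P U + Q K <= pi (U `*` K) + 1)%E.
Proof.
move=> [piP piQ] mU mK.
have mf : measurable (fst @^-1` U : set (Borel (X * X)%type)).
  rewrite -[X in measurable X]setTI.
  by apply: (continuous_measurable_Borel (fun x => cvg_fst)).
have ms : measurable (snd @^-1` K : set (Borel (X * X)%type)).
  rewrite -[X in measurable X]setTI.
  by apply: (continuous_measurable_Borel (fun x => cvg_snd)).
rewrite -(piP _ mU) -(piQ _ mK) -[U `*` K]/((fst @^-1` U) `&` (snd @^-1` K)).
have mI := measurableI _ _ mf ms.
have : (pi (~` ((fst @^-1` U) `&` (snd @^-1` K))) <=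
    pi (~` (fst @^-1` U)) + pi (~` (snd @^-1` K)))%E.
  rewrite setCI; apply: measureU2; exact: measurableC.
rewrite !Prob_setC// -(Prob_fineK pi mf) -(Prob_fineK pi ms) -(Prob_fineK pi mI).
by rewrite -!EFinB -!EFinD !lee_fin; lra.
Qed.

(** A Markov-type estimate: the nonnegative cost is integrated over [U]*[K] only, where it dominates
    the constant [d]. *)
Lemma coupling_cost_ge (R : realType) (X : ptopologicalType)
    (c : X -> X -> \bar R) (P Q : Prob X R) (pi : Prob (X * X)%type R)
    (U K : set X) (d : R) :
  cost_function c -> coupling P Q pi -> measurable (U : set (Borel X)) ->
  measurable (K : set (Borel X)) -> 0 <= d ->
  (forall x y, U x -> K y -> (d%:E <= c x y)%E) ->
  (d%:E * (P U + Q K - 1) <= \int[pi]_p c p.1 p.2)%E.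
Proof.
move=> [c0 lc] cpl mU mK d0 dc.
have mc := lsc_measurable_Borel lc.
have mUK : measurable (U `*` K : set (Borel (X * X)%type)).
  apply: (@measurableI _ (Borel (X * X)%type) (fst @^-1` U) (snd @^-1` K));
    rewrite -[X in measurable X]setTI.
  - by apply: (continuous_measurable_Borel (fun x => cvg_fst)).
  - by apply: (continuous_measurable_Borel (fun x => cvg_snd)).
apply: (@le_trans _ _ (d%:E * pi (U `*` K))%E).
  apply: lee_wpmul2l; first by rewrite lee_fin.
  by rewrite leeBlDr//; exact: coupling_rectangle.
rewrite -(integral_cst pi mUK).
apply: (@le_trans _ _ (\int[pi]_(p in U `*` K) c p.1 p.2)%E).
  apply: ge0_le_integral => //.
  - exact: measurable_funTS.
  - by move=> [x y] [/= Ux Ky]; exact: dc.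
apply: ge0_subset_integral => //.
Qed.

Lemma Prob_integral_indic (R : realType) (X : ptopologicalType) (P : Prob X R)
    (A : set X) :
  measurable (A : set (Borel X)) -> (\int[P]_x (\1_A x)%:E)%E = P A.
Proof.
move=> mA; transitivity (P (A `&` setT)); last by congr (P _); exact: setIT.
exact: (@integral_indic _ (Borel X)).
Qed.

Lemma bounded_continuous_integral_fin_num (R : realType) (X : ptopologicalType)
    (P : Prob X R) (f : X -> R) :
  bounded_continuous f -> (\int[P]_x (f x)%:E)%E \is a fin_num.
Proof.
move=> [cf [M fM]].
have mf := continuous_measurable_Borel_real cf.
apply: (@integrable_fin_num _ (Borel X)) => //.
apply: measurable_bounded_integrable => //.
  by rewrite [X in (X < _)%E]Prob_setT ltry.
exists M; split; first exact: num_real.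
by move=> N /ltW MN x _; exact: le_trans (fM x) MN.
Qed.

Lemma weak_open_integral_gt (R : realType) (X : ptopologicalType) (f : X -> R)
    (t : R) :
  bounded_continuous f ->
  weak_open [set Q : Prob X R | (t%:E < \int[Q]_x (f x)%:E)%E].
Proof.
move=> bf P /=; have fP := bounded_continuous_integral_fin_num P bf.
rewrite -(fineK fP) lte_fin => tP.
exists [:: f], (fine (\int[P]_x (f x)%:E)%E - t); split; first by rewrite subr_gt0.
split; first by move=> g; rewrite inE => /eqP ->.
move=> Q /= /(_ f (mem_head _ _)).
have fQ := bounded_continuous_integral_fin_num Q bf.
rewrite -(fineK fP) -(fineK fQ) -EFinB abse_EFin !lte_fin ltr_norml /=.
by move=> /andP[]; lra.
Qed.

Lemma coupling_cost_bound_near (R : realType) (X : completePseudoMetricType R)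
    (c : X -> X -> \bar R) (P Q : Prob X R) (F : set X) :
  separable_space X -> cost_function c -> (forall x y, c x y = 0%E -> x = y) ->
  closed F -> P F <> Q F ->
  exists (V : set (Prob X R)) (d : R), [/\ weak_open V, V P, 0 < d &
    forall eta pi, V eta -> coupling eta Q pi ->
      (d%:E <= \int[pi]_p c p.1 p.2)%E].
Proof.
move=> sX cc ceq0 cF PQF; have [c0 lc] := cc.
have [L [K [[cL kL] [cK kK] LK0 PL1]]] := disjoint_compact sX cF PQF.
have [x y Lx Ky|U [d [oU LU d0 dc]]] := lsc_gt_tube lc kL kK.
  rewrite lt0e c0 andbT; apply/eqP => /ceq0 xy.
  have : (L `&` K) x by split => //; rewrite xy.
  by rewrite LK0.
(* Urysohn function equal to 0 off [U] and 1 on [L]. Its integral lies above the mass of [L] and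
   below that of [U], and as a test function it is controlled by the weak topology, unlike these
   masses. *)
have [|f [cf fU fL f01]] := @urysohn_ext_itv X R pseudometric_normal (~` U) L 0 1
    (open_closedC oU) cL _ ltr01.
  by apply/disjoints_subset; exact: subsetC.
have {}f01 x : 0 <= f x <= 1.
  by have := f01 (f x) (ex_intro2 _ _ x I erefl); rewrite /= in_itv.
have bf : bounded_continuous f.
  by split => //; exists 1 => x; have /andP[f0 f1] := f01 x; rewrite ger0_norm.
have mf : measurable_fun (T := Borel X) setT (EFin \o f).
  by apply/measurable_EFinP; exact: continuous_measurable_Borel_real.
have mL : measurable (L : set (Borel X)) by exact: measurable_Borel_closed.
have mK : measurable (K : set (Borel X)) by exact: measurable_Borel_closed.
have mU : measurable (U : set (Borel X)) by exact: measurable_Borel_open.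
have Lf : (P L <= \int[P]_x (f x)%:E)%E.
  rewrite -(Prob_integral_indic P mL); apply: ge0_le_integral => //.
  - by apply/measurable_EFinP; exact: measurable_indic.
  move=> x _; rewrite lee_fin indicE; have [xL|xL] := boolP (x \in L).
  - by move: xL; rewrite inE => Lx; rewrite (fL (f x))//; exists x.
  - by have /andP[] := f01 x.
have fleU (eta : Prob X R) : (\int[eta]_x (f x)%:E <= eta U)%E.
  rewrite -(Prob_integral_indic eta mU); apply: ge0_le_integral => //.
  - by move=> x _; rewrite lee_fin; have /andP[] := f01 x.
  - by apply/measurable_EFinP; exact: measurable_indic.
  move=> x _; rewrite lee_fin indicE; have [xU|xU] := boolP (x \in U).
  - by have /andP[] := f01 x.
  - by move: xU; rewrite notin_setE => Ux; rewrite (fU (f x))//; exists x.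
move: PL1; rewrite -(Prob_fineK P mL) -(Prob_fineK Q mK) -EFinD lte_fin => PL1.
(* Midpoint of [1 - Q K] and [P L]: [t < P L] puts [P] in the neighbourhood, while [t + Q K - 1 > 0]
   makes the bound positive. *)
pose t := (1 - fine (Q K) + fine (P L)) / 2.
exists [set eta : Prob X R | (t%:E < \int[eta]_x (f x)%:E)%E], (d * (t + fine (Q K) - 1)).
split.
- exact: weak_open_integral_gt.
- apply: lt_le_trans Lf; rewrite -(Prob_fineK P mL) lte_fin /t; lra.
- by rewrite mulr_gt0// /t; lra.
move=> eta pi /= teta cpl.
apply: le_trans (coupling_cost_ge cc cpl mU mK (ltW d0) dc).
have := lt_le_trans teta (fleU eta).
rewrite -(Prob_fineK eta mU) lte_fin => tU.
have -> : Q K = (fine (Q K))%:E by rewrite Prob_fineK.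
rewrite -!EFinD -EFinM lee_fin ler_wpM2l ?(ltW d0)//=.
by rewrite lerD2r lerD2r ltW.
Qed.

(** * Transport costs, and uniform bounds over weakly compact sets *)

Lemma OTcost_scale_ge (R : realType) (X : ptopologicalType)
    (c : X -> X -> \bar R) (P Q : Prob X R) (r d : R) :
  cost_function c -> 0 <= r ->
  (forall pi, coupling P Q pi -> (d%:E <= \int[pi]_p c p.1 p.2)%E) ->
  ((r * d)%:E <= OTcost (scale_cost r c) P Q)%E.
Proof.
move=> [c0 lc] r0 dc; apply: le_ereal_inf_tmp => _ [pi cpl <-].
rewrite /scale_cost (@ge0_integralZl _ (Borel (X * X)%type))//.
- by rewrite EFinM; apply: lee_wpmul2l; [rewrite lee_fin|exact: dc].
- exact: lsc_measurable_Borel.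
Qed.

Lemma OTcost_ge0 (R : realType) (X : ptopologicalType)
    (c : X -> X -> \bar R) (P Q : Prob X R) :
  (forall x y, (0 <= c x y)%E) -> (0 <= OTcost c P Q)%E.
Proof.
by move=> c0; apply: le_ereal_inf_tmp => _ [pi _ <-]; exact: integral_ge0.
Qed.

(** The image of [P] under the diagonal map couples [P] with itself, and its cost only sees [c] on
    the diagonal. *)
Lemma OTcost_self (R : realType) (X : ptopologicalType)
    (c : X -> X -> \bar R) (P : Prob X R) :
  cost_function c -> (forall x, c x x = 0%E) -> (OTcost c P P <= 0)%E.
Proof.
move=> [c0 lc] cxx; pose diag (x : X) := (x, x).
have mdiag : measurable_fun (T := Borel X) (U := Borel (X * X)%type) setT diag.
  by apply: continuous_measurable_Borel => x; apply: cvg_pair.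
pose D : {mfun Borel X >-> Borel (X * X)%type} :=
  HB.pack diag (isMeasurableFun.Build _ _ (Borel X) (Borel (X * X)%type) diag mdiag).
pose pi : Prob (X * X)%type R := distribution P D.
apply: ereal_inf_le; exists (\int[pi]_p c p.1 p.2)%E; first by exists pi.
rewrite (@ge0_integral_distribution _ _ (Borel X) (Borel (X * X)%type) R P D)//.
- by rewrite integral0_eq// => x _; exact: cxx.
- exact: lsc_measurable_Borel.
Qed.

(* An element of [Prob X R] may take any value on a non-Borel set, so measures
   agreeing on Borel sets need not be equal; lower semicontinuity of [D] is what
   makes [D] insensitive to this difference. *)
Lemma weak_open_eq_closed (R : realType) (X : ptopologicalType)
    (A : set (Prob X R)) (P Q : Prob X R) :
  weak_open A -> A Q -> (forall F : set X, closed F -> P F = Q F) -> A P.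
Proof.
move=> wA AQ PQ; have [fs [e [e0 [bfs]]]] := wA Q AQ; apply => f /bfs bf.
have -> : (\int[P]_x (f x)%:E = \int[Q]_x (f x)%:E)%E.
  by apply: eq_measure_integral => B mB _; exact: Prob_ext_closed.
by rewrite subee ?abse0 ?lte_fin// bounded_continuous_integral_fin_num.
Qed.

Lemma weak_open_bigcup (R : realType) (X : ptopologicalType) (I : Type)
    (J : set I) (A : I -> set (Prob X R)) :
  (forall i, J i -> weak_open (A i)) -> weak_open (\bigcup_(i in J) A i).
Proof.
move=> wA P [i Ji AiP]; have [fs [e [e0 [bfs sA]]]] := wA i Ji P AiP.
by exists fs, e; split => //; split => // Q /sA AiQ; exists i.
Qed.

Lemma finite_set_nat_bound (J : set nat) :
  finite_set J -> exists N, forall n, J n -> (n <= N)%N.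
Proof.
move=> /finite_seqP[s ->]; exists (\max_(i <- s) i) => n ns.
exact: (@leq_bigmax_seq _ s xpredT id).
Qed.

Lemma coupling_cost_bound_compact (R : realType) (X : completePseudoMetricType R)
    (c : X -> X -> \bar R) (K : set (Prob X R)) (Q : Prob X R) :
  separable_space X -> cost_function c -> (forall x y, c x y = 0%E -> x = y) ->
  weak_compact K -> (forall P, K P -> exists2 F : set X, closed F & P F <> Q F) ->
  exists2 d : R, 0 < d & forall P pi, K P -> coupling P Q pi ->
    (d%:E <= \int[pi]_p c p.1 p.2)%E.
Proof.
move=> sX cc ceq0 kK KQ.
(* Bounds are discretised to [n.+1%:R^-1], so the cover is indexed by integers; a finite subcover
   has a largest index [N], which gives the uniform bound. *)
pose G n := [set V : set (Prob X R) | weak_open V /\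
  forall P pi, V P -> coupling P Q pi ->
    ((n.+1%:R^-1)%:E <= \int[pi]_p c p.1 p.2)%E].
have [n|P KP|J [/finite_set_nat_bound[N JN] KJ]] :=
    kK nat (fun n => \bigcup_(V in G n) V).
- by apply: weak_open_bigcup => V [].
- have [F cF PQF] := KQ P KP.
  have [V [d [wV VP d0 Vd]]] := coupling_cost_bound_near sX cc ceq0 cF PQF.
  have [n] := ltr_add_invr d0; rewrite add0r => nd.
  exists n => //; exists V => //; split => // P' pi VP' cpl.
  by apply: le_trans (Vd _ _ VP' cpl); rewrite lee_fin ltW.
exists N.+1%:R^-1; first by rewrite invr_gt0.
move=> P pi /KJ[n Jn [V [_ Vn] VP]] cpl; apply: le_trans (Vn _ _ VP cpl).
by rewrite lee_fin lef_pV2 ?posrE// ler_nat ltnS JN.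
Qed.

(** * Upper and lower bounds on the regularised divergence, and the limit *)

Lemma Dc_le (R : realType) (X : ptopologicalType)
    (D : Prob X R -> Prob X R -> \bar R) (c : X -> X -> \bar R)
    (nu mu : Prob X R) :
  cost_function c -> (forall x, c x x = 0%E) -> (Dc D c nu mu <= D nu mu)%E.
Proof.
move=> cc cxx; apply: ereal_inf_le; exists (D nu mu + OTcost c nu nu)%E.
  by exists nu.
by apply: geeDl; exact: OTcost_self.
Qed.

Lemma Dc_scale_near_ge (R : realType) (X : completePseudoMetricType R)
    (D : Prob X R -> Prob X R -> \bar R) (c : X -> X -> \bar R)
    (mu nu : Prob X R) (a : R) :
  separable_space X -> pre_divergence D -> cost_function c ->
  (forall x y, c x y = 0%E -> x = y) ->
  weak_lsc (fun P => D P mu) ->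
  weak_compact [set P | (D P mu <= a%:E)%E] ->
  (a%:E < D nu mu)%E ->
  \forall r \near +oo, (a%:E <= Dc D (scale_cost r c) nu mu)%E.
Proof.
move=> sX [D0 _] cc ceq0 lscD kD aD.
have [P /= Pa|d d0 Kd] := coupling_cost_bound_compact (Q := nu) sX cc ceq0 kD.
  (* If [P] agreed with [nu] on all closed sets, the weakly open set where [D] exceeds [a] would
     contain [P] along with [nu]. *)
  apply: contrapT => /forall2NP PQ.
  have /= : (a%:E < D P mu)%E.
    apply: (weak_open_eq_closed (lscD a) aD) => F cF.
    by have [//|/contrapT] := PQ F.
  by rewrite ltNge Pa.
near=> r.
have r0 : 0 <= r by near: r; exact: nbhs_pinfty_ge.
have rd : a <= r * d by rewrite -ler_pdivrMr//; near: r; exact: nbhs_pinfty_ge.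
apply: le_ereal_inf_tmp => _ [eta _ <-].
(* On the sublevel set the transport term alone reaches [a], since [a <= r * d]; off it the
   divergence term does. *)
have [etaa|aeta] := leP (D eta mu) a%:E.
  apply: (@le_trans _ _ (0 + (r * d)%:E)%E); first by rewrite add0e lee_fin.
  apply: leeD => //; apply: OTcost_scale_ge => // pi; exact: Kd.
rewrite -[leLHS]adde0; apply: leeD; first exact: ltW.
apply: OTcost_ge0 => x y; rewrite mule_ge0 ?lee_fin//; exact: cc.1.
Unshelve. all: by end_near. Qed.

Lemma cost_function_scale (R : realType) (X : ptopologicalType)
    (c : X -> X -> \bar R) (r : R) :
  0 < r -> cost_function c -> cost_function (scale_cost r c).
Proof.
move=> r0 [c0 lc]; split=> [x y|p a].
  by rewrite mule_ge0// lee_fin ltW.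
rewrite /scale_cost -lte_pdivrMl// -EFinM => /lc[V pV cV]; exists V => // q /cV.
by rewrite EFinM lte_pdivrMl.
Qed.

Lemma ereal_squeeze_below (R : realType) (T : Type) (F : set_system T)
    (f : T -> \bar R) (l : \bar R) :
  Filter F -> (\forall x \near F, (f x <= l)%E) ->
  (forall a : R, (a%:E < l)%E -> \forall x \near F, (a%:E <= f x)%E) ->
  l != -oo%E -> f @ F --> l.
Proof.
move=> FF; case: l => [l| |] fl lf //= _.
- apply/fine_cvgP; split.
    (* The bounds [l - 1] and [l] make [f] eventually finite, so the limit can be taken among real
       numbers. *)
    have := lf (l - 1); rewrite lte_fin ltrBlDr ltrDl ltr01 => /(_ isT) lf1.
    apply: filterS2 fl lf1 => x; case: (f x) => //=.
  apply/cvgrPdist_le => e e0.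
  have := lf (l - e); rewrite lte_fin ltrBlDr ltrDl => /(_ e0) lfe.
  apply: filterS2 fl lfe => x /=; case: (f x) => //= r.
  by rewrite !lee_fin => rl ler; rewrite ger0_norm; lra.
- apply/cvgeyPge => a; apply: lf; exact: ltry.
Qed.

Unset Implicit Arguments.

Theorem theorem5 (R : realType) (X : completePseudoMetricType R)
  (hX : hausdorff_space X) (sX : separable_space X)
  (D : Prob X R -> Prob X R -> \bar R) (c : X -> X -> \bar R) (mu : Prob X R) :
  pre_divergence D -> cost_function c ->
  weak_lsc (fun P => D P mu) ->
  (forall t : R, weak_compact [set P | (D P mu <= t%:E)%E]) ->
  (forall x1 x2, c x1 x2 = 0%E <-> x1 = x2) ->
  forall nu : Prob X R,
    Dc D (scale_cost r c) nu mu @[r --> +oo] --> D nu mu.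
Proof.
move=> pD cc lscD kD ceq0 nu; apply: ereal_squeeze_below.
- near=> r; have r0 : 0 < r by near: r; exact: nbhs_pinfty_gt.
  apply: Dc_le; first exact: cost_function_scale.
  by move=> x; rewrite /scale_cost (ceq0 x x).2// mule0.
- by move=> a; apply: Dc_scale_near_ge => // x y /ceq0.
- by rewrite gt_eqF// (lt_le_trans _ (pD.1 nu mu))// ltNy0.
Unshelve. all: by end_near. Qed.
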